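(* Let $f_k:\mathbb{R}^n\to\mathbb{R}$, $1\le k\le m$, be quadratic forms $f_k(x)=\frac12x^TA_kx$ with $A_k\in\mathbb{R}^{n\times n}$, let $f=\frac1m\sum_{k=1}^mf_k$, and for $\alpha>0$ let $$G_\alpha(\mathbf{x})=\frac{\alpha}{m}\sum_{k=1}^mf_k(x_k)+\frac12\mathbf{x}^T(I-W\otimes I_n)\mathbf{x},\qquad\mathbf{x}=(x_1,\dots,x_m)\in\mathbb{R}^{nm}.$$ (1) Assume that each $f_k$ is convex and that $f$ is $\mu$-strongly convex for some $\mu>0$. Then $G_\alpha$ is strongly convex for any $\alpha>0$. (2) Assume that $f$ is $\mu$-strongly convex for some $\mu>0$. Then there exists a value $\alpha_0>0$ such that $G_\alpha$ is strongly convex for every $\alpha$ with $0<\alpha<\alpha_0$.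
   Context: $W=\{w_{ij}\}_{1\le i,j\le m}$ is a matrix with nonnegative entries associated with an undirected connected graph $\mathcal{G}=(\mathcal{V},\mathcal{E})$ on $\mathcal{V}=\{1,\dots,m\}$: for $i\neq j$, $w_{ij}>0$ if and only if $\{i,j\}\in\mathcal{E}$; $w_{ii}>0$ for all $i$; and $W$ is doubly stochastic ($W\mathbf{1}=\mathbf{1}$, $\mathbf{1}^TW=\mathbf{1}^T$). $I_n$ is the $n\times n$ identity, $I$ is the $nm\times nm$ identity, and $\mathbf{x}^T(I-W\otimes I_n)\mathbf{x}=\sum_{k}\|x_k\|^2-\sum_{k,j}w_{kj}x_k^Tx_j$. A differentiable function $g$ is $\mu$-strongly convex ($\mu>0$) if $g(y)\ge g(x)+\langle\nabla g(x),y-x\rangle+\frac{\mu}{2}\|y-x\|^2$ for all $x,y$, and strongly convex if it is $\mu$-strongly convex for some $\mu>0$. *)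

(* Defs.v *)
From mathcomp Require Import all_boot all_order all_algebra.
From mathcomp.real_closed Require Export mxtens.
From mathcomp Require Import all_classical all_reals all_analysis.

Set Implicit Arguments.
Unset Strict Implicit.
Unset Printing Implicit Defensive.

Import Order.TTheory GRing.Theory Num.Theory.
Import numFieldNormedType.Exports.

Local Open Scope classical_set_scope.
Local Open Scope ring_scope.

Definition dotv (R : realType) (d : nat) (u v : 'cV[R]_d) : R :=
  (u^T *m v) 0 0.

Definition gradient (R : realType) (d : nat) (g : 'cV[R]_d -> R)
    (x : 'cV[R]_d) : 'cV[R]_d :=
  \col_i 'D_(delta_mx i 0) g x.

(* The library norm on matrices is the sup norm, hence [dotv (y - x) (y - x)]
   for the squared Euclidean norm; the topology, and therefore
   differentiability, is the same for both norms. *)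
Definition mu_strongly_convex (R : realType) (d : nat) (mu : R)
    (g : 'cV[R]_d -> R) : Prop :=
  (forall x, differentiable g x) /\
  forall x y, g y >= g x + dotv (gradient g x) (y - x)
                     + mu / 2 * dotv (y - x) (y - x).

Definition strongly_convex (R : realType) (d : nat) (g : 'cV[R]_d -> R) : Prop :=
  exists2 mu : R, 0 < mu & mu_strongly_convex mu g.

Definition connected_graph (m : nat) (e : rel 'I_m) : Prop :=
  [/\ symmetric e, irreflexive e & forall i j, connect e i j].

Definition mixing_matrix (R : realType) (m : nat) (e : rel 'I_m)
    (W : 'M[R]_m) : Prop :=
  [/\ forall i j, 0 <= W i j,
      forall i j, i != j -> (0 < W i j <-> e i j),
      forall i, 0 < W i i,
      W *m (const_mx 1 : 'cV[R]_m) = const_mx 1 &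
      (const_mx 1 : 'rV[R]_m) *m W = const_mx 1].

Definition quad_form (R : realType) (n : nat) (A : 'M[R]_n) (x : 'cV[R]_n) : R :=
  1 / 2 * (x^T *m A *m x) 0 0.

Definition mean_fun (R : realType) (m n : nat) (f : 'I_m -> 'cV[R]_n -> R)
    (x : 'cV[R]_n) : R :=
  1 / m%:R * \sum_(k < m) f k x.

(* The block x_k of x = (x_1, ..., x_m), in the indexing used by [*t], for which
   (W *t 1%:M) (mxtens_index (k, i)) (mxtens_index (j, l)) = W k j * (i == l). *)
Definition block (R : realType) (m n : nat) (x : 'cV[R]_(m * n)) (k : 'I_m) :
    'cV[R]_n :=
  \col_i x (mxtens_index (k, i)) 0.

Definition G (R : realType) (m n : nat) (W : 'M[R]_m)
    (f : 'I_m -> 'cV[R]_n -> R) (alpha : R) (x : 'cV[R]_(m * n)) : R :=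
  alpha / m%:R * \sum_(k < m) f k (block x k)
  + 1 / 2 * (x^T *m (1%:M - W *t (1%:M : 'M[R]_n)) *m x) 0 0.

(* Main.v *)
(* A quadratic form q is strongly convex iff q(h) >= c |h|^2 for some c > 0,
   and x^T (I - W (x) I_n) x is half the energy sum_{k,j} w_kj |x_k - x_j|^2,
   by double stochasticity.  Fix a vertex r and write x_k = x_r + z_k.
   Connectedness bounds sum_k |z_k|^2 by a constant times the energy, while
   sum_k f_k(x_k) >= c |x_r|^2 - K sum_k |z_k|^2 by strong convexity of the
   mean and AM-GM on the cross terms, so for small alpha the energy absorbs the
   negative term; this is (2).  For (1), convex quadratic forms are
   nonnegative, so G_alpha increases with alpha and (2) suffices. *)
Require Import Defs.
From mathcomp Require Import all_boot all_order all_algebra.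
From mathcomp Require Import all_classical all_reals all_analysis.
From mathcomp Require Import ring lra.

Import Order.TTheory GRing.Theory Num.Theory.
Import numFieldNormedType.Exports.

Local Open Scope classical_set_scope.
Local Open Scope ring_scope.

Set Implicit Arguments.
Unset Strict Implicit.
Unset Printing Implicit Defensive.

(** * Bilinearity and basic inequalities of the Euclidean inner product *)

Lemma dotvE (R : realType) d (u v : 'cV[R]_d) : dotv u v = \sum_i u i 0 * v i 0.
Proof. by rewrite /dotv mxE; apply: eq_bigr => i _; rewrite mxE. Qed.

Lemma dotvC (R : realType) d (u v : 'cV[R]_d) : dotv u v = dotv v u.
Proof. by rewrite !dotvE; apply: eq_bigr => i _; rewrite mulrC. Qed.

Lemma dotvDr (R : realType) d (u v w : 'cV[R]_d) :
  dotv u (v + w) = dotv u v + dotv u w.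
Proof. by rewrite /dotv mulmxDr mxE. Qed.

Lemma dotvZr (R : realType) d a (u v : 'cV[R]_d) :
  dotv u (a *: v) = a * dotv u v.
Proof. by rewrite /dotv -scalemxAr mxE. Qed.

Lemma dotvDl (R : realType) d (u v w : 'cV[R]_d) :
  dotv (u + v) w = dotv u w + dotv v w.
Proof. by rewrite !(dotvC _ w) dotvDr. Qed.

Lemma dotvZl (R : realType) d a (u v : 'cV[R]_d) :
  dotv (a *: u) v = a * dotv u v.
Proof. by rewrite !(dotvC _ v) dotvZr. Qed.

Lemma dotvNr (R : realType) d (u v : 'cV[R]_d) : dotv u (- v) = - dotv u v.
Proof. by rewrite -scaleN1r dotvZr mulN1r. Qed.

Lemma dotvNl (R : realType) d (u v : 'cV[R]_d) : dotv (- u) v = - dotv u v.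
Proof. by rewrite !(dotvC _ v) dotvNr. Qed.

Lemma dotv_sumr (R : realType) d I (r : seq I)
    (u : 'cV[R]_d) (F : I -> 'cV[R]_d) :
  dotv u (\sum_(i <- r) F i) = \sum_(i <- r) dotv u (F i).
Proof. by rewrite /dotv mulmx_sumr summxE. Qed.

Lemma dotvv_ge0 (R : realType) d (u : 'cV[R]_d) : 0 <= dotv u u.
Proof. by rewrite dotvE; apply: sumr_ge0 => i _; rewrite -expr2 sqr_ge0. Qed.

Lemma dotv_mulmxl (R : realType) p q (M : 'M[R]_(p, q)) u v :
  dotv (M *m u) v = dotv u (M^T *m v).
Proof. by rewrite /dotv trmx_mul mulmxA. Qed.

Lemma dotv_delta (R : realType) d (u : 'cV[R]_d) i :
  dotv u (delta_mx i 0) = u i 0.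
Proof.
rewrite dotvE (bigD1 i) //= big1 => [|j /negPf ji].
  by rewrite mxE !eqxx mulr1 addr0.
by rewrite mxE ji mulr0.
Qed.

Lemma dotvD_le (R : realType) d (u v : 'cV[R]_d) :
  dotv (u + v) (u + v) <= 2 * dotv u u + 2 * dotv v v.
Proof.
have := dotvv_ge0 (u - v).
rewrite !(dotvDl, dotvDr, dotvNl, dotvNr) (dotvC v u); lra.
Qed.

(** * Quadratic forms: derivatives, strong convexity, convexity *)

Lemma quad_formE (R : realType) d (M : 'M[R]_d) x :
  quad_form M x = 1 / 2 * dotv x (M *m x).
Proof. by rewrite /quad_form /dotv mulmxA. Qed.

Lemma quad_formD (R : realType) d (M : 'M[R]_d) x h :
  quad_form M (x + h) = quad_form M x
    + 1 / 2 * (dotv x (M *m h) + dotv h (M *m x)) + quad_form M h.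
Proof. rewrite !quad_formE mulmxDr !(dotvDl, dotvDr); ring. Qed.

Lemma quad_formZ (R : realType) d (M : 'M[R]_d) a x :
  quad_form M (a *: x) = a ^+ 2 * quad_form M x.
Proof. rewrite !quad_formE -scalemxAr dotvZl dotvZr; ring. Qed.

Lemma differentiable_quad_form (R : realType) d (M : 'M[R]_d) x :
  differentiable (quad_form M) x.
Proof.
have -> : quad_form M = 1 / 2 \*:
    (\sum_i (fun y : 'cV[R]_d => y i 0) *
            (\sum_j (M i j \*: (fun y : 'cV[R]_d => y j 0)))).
  apply/funext => y; rewrite quad_formE dotvE fct_sumE /=.
  congr (_ * _); apply: eq_bigr => i _; rewrite mxE; congr (_ * _).
  by rewrite fct_sumE.
apply: differentiableZ; apply: differentiable_sum => i.
apply: differentiableM; first exact: differentiable_coord.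
apply: differentiable_sum => j; apply: differentiableZ.
exact: differentiable_coord.
Qed.

Lemma derive_quad_form (R : realType) d (M : 'M[R]_d) x v :
  'D_v (quad_form M) x = 1 / 2 * (dotv x (M *m v) + dotv v (M *m x)).
Proof.
apply/cvg_lim => //; set b := 1 / 2 * _.
(* For [h != 0] the difference quotient along [v] equals [b + h * quad_form M v] exactly, so its
   limit is [b]. *)
have : (fun h : R => b + h * quad_form M v) @ 0^' --> b + 0 * quad_form M v.
  apply: cvgD; first exact: cvg_cst.
  by apply: cvgM; [exact: nbhs_dnbhs|exact: cvg_cst].
rewrite mul0r addr0; apply: cvg_trans; apply: near_eq_cvg.
near=> h.
rewrite /= addrC quad_formD quad_formZ -scalemxAr dotvZl dotvZr /b.
rewrite /GRing.scale /=.
have h0 : h != 0 by near: h; exact: nbhs_dnbhs_neq.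
by field.
Unshelve. all: by end_near. Qed.

Lemma dotv_gradient_quad_form (R : realType) d (M : 'M[R]_d) x v :
  dotv (gradient (quad_form M) x) v
  = 1 / 2 * (dotv x (M *m v) + dotv v (M *m x)).
Proof.
have -> : gradient (quad_form M) x = 1 / 2 *: (M^T *m x + M *m x).
  apply/colP => i; rewrite [LHS]mxE derive_quad_form -[RHS]dotv_delta.
  by rewrite dotvZl dotvDl dotv_mulmxl trmxK (dotvC _ (M *m x)).
by rewrite dotvZl dotvDl dotv_mulmxl trmxK (dotvC _ (M *m x)).
Qed.

(* The Bregman divergence of a quadratic form [q] is [q (y - x)]. *)
Lemma strongly_convex_quad_form (R : realType) d (M : 'M[R]_d) :
  strongly_convex (quad_form M) <->
  exists2 c : R, 0 < c & forall h, c * dotv h h <= quad_form M h.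
Proof.
split=> [[mu mu0 [_ /(_ 0) H]]|[c c0 H]].
  (* At base point [0] both the value and the gradient vanish, which leaves only the quadratic
     term. *)
  exists (mu / 2) => [|h]; first by rewrite divr_gt0.
  have := H h; rewrite subr0 dotv_gradient_quad_form -(scale0r h).
  rewrite quad_formZ -scalemxAr dotvZl dotvZr; lra.
exists (2 * c); first by rewrite mulr_gt0.
split=> [x|x y]; first exact: differentiable_quad_form.
have -> : quad_form M y = quad_form M (x + (y - x)) by rewrite addrC subrK.
rewrite quad_formD dotv_gradient_quad_form; have := H (y - x); lra.
Qed.

(** Convexity at the midpoint of [x] and [- x]: the form vanishes at the midpoint [0] and takes the
    same value at both ends. *)
Lemma convex_quad_form_ge0 (R : realType) d (M : 'M[R]_d) :
  convex_function setT (quad_form M) -> forall x, 0 <= quad_form M x.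
Proof.
move=> cM x.
have h0 : 0 <= 2^-1 :> R by lra.
have h1 : 2^-1 <= 1 :> R by lra.
have := cM (Itv01 h0 h1) x (- x) (in_setT _) (in_setT _).
rewrite /conv /= /conv /= /unstable.onem
        scalerN -(scaleNr _ x) -scalerDl -(scaleN1r x) !quad_formZ.
rewrite /GRing.scale /=; lra.
Qed.

(** * Uniform constants over finite families and bounds on bilinear forms *)

Lemma finite_uniform_bound (R : realType) (I : finType) (P : I -> R -> Prop) :
  (forall i a b, a <= b -> P i a -> P i b) -> (forall i, exists a, P i a) ->
  exists2 a, 0 < a & forall i, P i a.
Proof.
move=> P_mono /choice[f Pf]; exists (1 + \sum_i `|f i|) => [|i].
  by rewrite ltr_pwDl// sumr_ge0.
apply: P_mono (Pf i); rewrite (le_trans (ler_norm _))// (bigD1 i)//= addrCA.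
by rewrite lerDl addr_ge0// sumr_ge0.
Qed.

Lemma weighted_AM_GM (R : realType) (t a b : R) :
  0 < t -> a * b <= t * a ^+ 2 + b ^+ 2 / t.
Proof.
move=> t0; rewrite -subr_ge0.
(* Completing the square would need only [b ^+ 2 / (4 * t)]; the looser bound is invariant under
   swapping [a], [b] and inverting [t]. *)
have -> : t * a ^+ 2 + b ^+ 2 / t - a * b
    = t * (a - b / (2 * t)) ^+ 2 + 3 / 4 * (b ^+ 2 / t) by field; lra.
rewrite addr_ge0//; first by rewrite mulr_ge0 ?sqr_ge0 ?ltW.
by rewrite mulr_ge0 ?divr_ge0 ?sqr_ge0 ?ltW.
Qed.

Lemma sqr_entry_le_dotv (R : realType) d (u : 'cV[R]_d) i :
  u i 0 ^+ 2 <= dotv u u.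
Proof.
rewrite dotvE (bigD1 i)//= -expr2 lerDl.
by apply: sumr_ge0 => j _; rewrite -expr2 sqr_ge0.
Qed.

(** Weighted AM-GM on each entry of [M]. Since [K] does not depend on [t], the share charged to [u]
    can later be made as small as desired. *)
Lemma bilinear_lower_bound (R : realType) d (M : 'M[R]_d) :
  exists K : R, forall t u v, 0 < t ->
    - (K * (t * dotv u u + dotv v v / t)) <= dotv u (M *m v).
Proof.
exists (\sum_i \sum_j `|M i j|) => t u v t0.
rewrite [leRHS]dotvE mulr_suml -sumrN; apply: ler_sum => i _.
rewrite mxE mulr_sumr mulr_suml -sumrN; apply: ler_sum => j _.
rewrite mulrCA lerNl -mulrN (le_trans (ler_norm _))// normrM ler_wpM2l//.
rewrite normrN normrM (le_trans (weighted_AM_GM _ _ t0))// !real_normK ?num_real//.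
by rewrite lerD ?ler_wpM2l ?ler_wpM2r ?sqr_entry_le_dotv ?invr_ge0// ltW.
Qed.

(** * The graph energy and its control of differences between vertices *)

Section energy.
Variables (R : realType) (m n : nat).
Implicit Types (W : 'M[R]_m) (u : 'I_m -> 'cV[R]_n).

Definition energy W u : R :=
  \sum_k \sum_j W k j * dotv (u k - u j) (u k - u j).

Lemma energy_ge0 W u : (forall i j, 0 <= W i j) -> 0 <= energy W u.
Proof.
move=> W0; apply: sumr_ge0 => i _; apply: sumr_ge0 => j _.
by rewrite mulr_ge0// dotvv_ge0.
Qed.

Lemma edge_le_energy W u i j : (forall i j, 0 <= W i j) ->
  W i j * dotv (u i - u j) (u i - u j) <= energy W u.
Proof.
move=> W0; rewrite /energy (bigD1 i)//= (bigD1 j)//= -addrA lerDl addr_ge0//.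
  by apply: sumr_ge0 => k _; rewrite mulr_ge0// dotvv_ge0.
apply: sumr_ge0 => k _; apply: sumr_ge0 => l _.
by rewrite mulr_ge0// dotvv_ge0.
Qed.

(** Induction along a path: an edge difference costs at most the energy divided by the positive edge
    weight, and [dotvD_le] contributes a factor 2 per step. The constant depends on the path but not
    on [u]. *)
Lemma connect_le_energy W (e : rel 'I_m) i j : (forall i j, 0 <= W i j) ->
  (forall i j, e i j -> 0 < W i j) -> connect e i j ->
  exists C : R, forall u, dotv (u i - u j) (u i - u j) <= C * energy W u.
Proof.
move=> W0 We /connectP[p]; elim: p i => [i _ ->|k p IH i /= /andP[eik ekp] jE].
  by exists 0 => u /=; rewrite subrr -(scale0r 0) dotvZl !mul0r.
have [C HC] := IH k ekp jE.
exists (2 * (W i k)^-1 + 2 * C) => u.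
rewrite -(subrKA (u k) (u i) (- u j)); apply: le_trans (dotvD_le _ _) _.
rewrite [leRHS]mulrDl -!mulrA lerD// ?ler_pM2l// ler_pdivlMl ?We//.
exact: edge_le_energy.
Qed.

(** After expanding the squares, unit row sums collapse the terms in [u k] and unit column sums
    those in [u j]. *)
Lemma energy_dotv W (hrow : W *m (const_mx 1 : 'cV[R]_m) = const_mx 1)
  (hcol : (const_mx 1 : 'rV[R]_m) *m W = const_mx 1) u :
  energy W u = 2 * \sum_k dotv (u k) (u k)
    - 2 * \sum_k \sum_j W k j * dotv (u k) (u j).
Proof.
have rowE k : \sum_j W k j = 1.
  have /colP/(_ k) := hrow; rewrite !mxE => <-.
  by apply: eq_bigr => j _; rewrite mxE mulr1.
have colE j : \sum_k W k j = 1.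
  have /rowP/(_ j) := hcol; rewrite !mxE => <-.
  by apply: eq_bigr => k _; rewrite mxE mul1r.
have -> : energy W u = \sum_k \sum_j W k j * dotv (u k) (u k)
    + \sum_k \sum_j W k j * dotv (u j) (u j)
    - 2 * \sum_k \sum_j W k j * dotv (u k) (u j).
  rewrite mulr_sumr -sumrN -!big_split; apply: eq_bigr => k _ /=.
  rewrite mulr_sumr -sumrN -!big_split; apply: eq_bigr => j _ /=.
  rewrite !(dotvDl, dotvDr, dotvNl, dotvNr) (dotvC (u j) (u k)); ring.
rewrite [X in _ + X - _]exchange_big /=.
under eq_bigr do rewrite -mulr_suml rowE mul1r.
under [X in _ + X - _]eq_bigr do rewrite -mulr_suml colE mul1r.
ring.
Qed.

(** * Block decomposition of stacked vectors and the Kronecker product *)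

Lemma blockE (x : 'cV[R]_(m * n)) k :
  block x k = rowsub (fun i => mxtens_index (k, i)) 1%:M *m x.
Proof. by rewrite -rowsubE; apply/colP => i; rewrite !mxE. Qed.

Lemma dotv_block (x y : 'cV[R]_(m * n)) :
  dotv x y = \sum_k dotv (block x k) (block y k).
Proof.
under eq_bigr do rewrite dotvE.
rewrite pair_bigA dotvE (reindex (@mxtens_index m n))/=.
  by apply: eq_bigr => -[k i] _; rewrite !mxE.
by exists (@mxtens_unindex m n) => ? _; [exact: mxtens_indexK|exact: mxtens_unindexK].
Qed.

Lemma block_tensmx W (x : 'cV[R]_(m * n)) k :
  block ((W *t 1%:M) *m x) k = \sum_j W k j *: block x j.
Proof.
apply/colP => i; rewrite !mxE summxE.
transitivity (\sum_j \sum_l (W *t 1%:M) (mxtens_index (k, i))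
    (mxtens_index (j, l)) * x (mxtens_index (j, l)) 0).
  rewrite pair_bigA (reindex (@mxtens_index m n))/=.
    by apply: eq_bigr => -[j l].
  by exists (@mxtens_unindex m n) => ? _;
    [exact: mxtens_indexK|exact: mxtens_unindexK].
(* The identity factor of the Kronecker product keeps only [l = i]. *)
apply: eq_bigr => j _; rewrite (bigD1 i)//= big1 ?addr0.
  by rewrite tensmxE !mxE eqxx mulr1.
by move=> l /negPf li; rewrite tensmxE mxE eq_sym li mulr0 mul0r.
Qed.

End energy.

(** * The objective as a quadratic form, and the bounds behind its coercivity *)

Section objective.
Variables (R : realType) (m n : nat).
Implicit Types (W : 'M[R]_m) (A : 'I_m -> 'M[R]_n).

Lemma mean_fun_quad_form A : mean_fun (fun k => quad_form (A k))
  = quad_form (1 / m%:R *: \sum_k A k).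
Proof.
apply/funext => x; rewrite quad_formE -scalemxAl dotvZr mulmx_suml dotv_sumr.
rewrite mulrCA mulr_sumr /mean_fun; congr (_ * _).
by apply: eq_bigr => k _; rewrite quad_formE.
Qed.

(** Each [A k] is pulled back along the matrix [S k] that selects block [k]. This makes the
    coercivity criterion for quadratic forms available for [G]. *)
Lemma G_quad_form W A alpha :
  exists Q, G W (fun k => quad_form (A k)) alpha = quad_form Q.
Proof.
pose S k : 'M[R]_(n, m * n) := rowsub (fun i => mxtens_index (k, i)) 1%:M.
exists (alpha / m%:R *: (\sum_k (S k)^T *m A k *m S k) + (1%:M - W *t 1%:M)).
apply/funext => x; rewrite /G quad_formE mulmxDl dotvDr mulrDr.
congr (_ + _); last by rewrite /dotv mulmxA.
rewrite -scalemxAl dotvZr mulmx_suml dotv_sumr [RHS]mulrCA; congr (_ * _).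
rewrite mulr_sumr; apply: eq_bigr => k _.
by rewrite quad_formE blockE dotv_mulmxl !mulmxA.
Qed.

Lemma strongly_convex_G W A alpha :
  strongly_convex (G W (fun k => quad_form (A k)) alpha) <->
  exists2 c : R, 0 < c &
    forall x, c * dotv x x <= G W (fun k => quad_form (A k)) alpha x.
Proof.
by have [Q ->] := G_quad_form W A alpha; exact: strongly_convex_quad_form.
Qed.

(** The coefficient 1/4 is the 1/2 in [G] times the 1/2 relating the form of [1%:M - W *t 1%:M] to
    the energy. *)
Lemma G_energy W f alpha (x : 'cV[R]_(m * n)) :
  W *m (const_mx 1 : 'cV[R]_m) = const_mx 1 ->
  (const_mx 1 : 'rV[R]_m) *m W = const_mx 1 ->
  G W f alpha x =
    alpha / m%:R * (\sum_k f k (block x k)) + 1 / 4 * energy W (block x).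
Proof.
move=> hrow hcol; rewrite /G energy_dotv//; congr (_ + _).
rewrite -mulmxA -/(dotv _ _) mulmxBl mul1mx dotvDr dotvNr.
rewrite (dotv_block x x) (dotv_block x (_ *m _)).
under [X in _ - X]eq_bigr do rewrite block_tensmx dotv_sumr.
under [X in _ - X]eq_bigr do under eq_bigr do rewrite dotvZr.
by field.
Qed.

(** A Poincare inequality anchored at the vertex [r] instead of the mean: paths to [r] give one
    constant per vertex, which is made uniform and summed over the [m] vertices. *)
Lemma energy_spectral_gap W (e : rel 'I_m) (r : 'I_m) :
  (forall i j, 0 <= W i j) -> (forall i j, e i j -> 0 < W i j) ->
  (forall i j, connect e i j) ->
  exists2 C : R, 0 < C & forall u : 'I_m -> 'cV[R]_n,
    \sum_k dotv (u k - u r) (u k - u r) <= C * energy W u.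
Proof.
move=> W0 We ce.
have [C C0 HC] : exists2 C : R, 0 < C & forall k (u : 'I_m -> 'cV[R]_n),
    dotv (u k - u r) (u k - u r) <= C * energy W u.
  apply: finite_uniform_bound => [k a b ab Ha u|k].
    by rewrite (le_trans (Ha u))// ler_wpM2r// energy_ge0.
  exact: connect_le_energy W0 We (ce k r).
have m0 : (0 < m)%N by case: r {HC} => k; exact: leq_ltn_trans.
exists (m%:R * C) => [|u]; first by rewrite mulr_gt0 ?ltr0n.
have -> : m%:R * C * energy W u = \sum_(k < m) C * energy W u.
  by rewrite sumr_const card_ord -mulrA mulr_natl.
exact: ler_sum.
Qed.

Lemma sum_quad_form_lower_bound A (mu : R) : 0 < mu ->
  exists2 K, 0 < K & forall (v : 'cV[R]_n) (z : 'I_m -> 'cV[R]_n),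
    (\sum_k quad_form (A k) v) - mu * m%:R * dotv v v
      - K * \sum_k dotv (z k) (z k)
    <= \sum_k quad_form (A k) (v + z k).
Proof.
move=> mu0.
have [K K0 HK] : exists2 K : R, 0 < K & forall k t (u v : 'cV[R]_n), 0 < t ->
    - (K * (t * dotv u u + dotv v v / t)) <= dotv u (A k *m v).
  apply: finite_uniform_bound => [k a b ab Ha t u v t0|k].
    apply: le_trans (Ha t u v t0); rewrite lerN2 ler_wpM2r// addr_ge0//.
      by rewrite mulr_ge0 ?dotvv_ge0// ltW.
    by rewrite divr_ge0 ?dotvv_ge0// ltW.
  exact: bilinear_lower_bound.
(* The two halved cross terms together cost [K * t = mu] on [dotv v v] and [K / t] on
   [dotv (z k) (z k)]; the form at [z k] costs a further [K]. *)
pose t := mu / K; have t0 : 0 < t by rewrite divr_gt0.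
exists (K * (1 + t^-1)) => [|v z]; first by rewrite mulr_gt0 ?addr_gt0 ?invr_gt0.
have -> : mu * m%:R * dotv v v = \sum_(k < m) mu * dotv v v.
  rewrite sumr_const card_ord -[RHS]mulr_natl; ring.
rewrite mulr_sumr -!sumrB; apply: ler_sum => k _.
rewrite quad_formD (quad_formE _ (z k)).
have := HK k t v (z k) t0.
have := HK k t^-1 (z k) v; rewrite invr_gt0 invrK => /(_ t0).
have := HK k 1 (z k) (z k) ltr01.
have -> : mu = K * t by rewrite /t mulrCA divff ?mulr1// gt_eqF.
rewrite invr1; nra.
Qed.

(** Each block is split as [block x r] plus its deviation, so coercivity in the anchor and the
    deviations yields coercivity in [x]. *)
Lemma dotv_block_le (r : 'I_m) (x : 'cV[R]_(m * n)) :
  dotv x x <= 2 * m%:R * dotv (block x r) (block x r)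
    + 2 * \sum_k dotv (block x k - block x r) (block x k - block x r).
Proof.
have -> : 2 * m%:R * dotv (block x r) (block x r)
    = \sum_(k < m) 2 * dotv (block x r) (block x r).
  rewrite sumr_const card_ord -[RHS]mulr_natl; ring.
rewrite dotv_block mulr_sumr -big_split; apply: ler_sum => k _ /=.
by rewrite -{1 2}(subrKC (block x r) (block x k)) dotvD_le.
Qed.

End objective.

Theorem theorem2p1 (R : realType) (m n : nat) (hm : (0 < m)%N)
    (e : rel 'I_m) (he : connected_graph e)
    (W : 'M[R]_m) (hW : mixing_matrix e W)
    (A : 'I_m -> 'M[R]_n) :
  let f := fun k : 'I_m => quad_form (A k) in
  ((forall k, convex_function setT (f k)) ->
   strongly_convex (mean_fun f) ->
   forall alpha : R, 0 < alpha -> strongly_convex (G W f alpha))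
  /\
  (strongly_convex (mean_fun f) ->
   exists2 alpha0 : R, 0 < alpha0 &
     forall alpha : R, 0 < alpha < alpha0 -> strongly_convex (G W f alpha)).
Proof.
move=> f; case: he => _ irr_e conn_e; case: hW => W0 We _ hrow hcol.
have m0 : 0 < m%:R :> R by rewrite ltr0n.
pose r := Ordinal hm.
have small : strongly_convex (mean_fun f) -> exists2 alpha0 : R, 0 < alpha0 &
    forall alpha, 0 < alpha < alpha0 -> strongly_convex (G W f alpha).
  rewrite /f mean_fun_quad_form strongly_convex_quad_form -/f => -[mu mu0 Hmu].
  have We' i j : e i j -> 0 < W i j.
    move=> eij; apply/We => //; apply/eqP => ij.
    by rewrite ij irr_e in eij.
  have [C C0 HC] := @energy_spectral_gap R m n W e r W0 We' conn_e.
  (* Only half of the coercivity of the mean is spent on cross terms; the other half survives in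
     [fx]. *)
  have mu2 : 0 < mu / 2 by rewrite divr_gt0.
  have [K K0 HK] := sum_quad_form_lower_bound A mu2.
  (* Below this threshold the loss [alpha / m%:R * K * Z] is at most [Z / (8 * C)], half of the
     [Z / (4 * C)] supplied by the energy. *)
  exists (m%:R / (8 * C * K)) => [|alpha /andP[a0 aa0]].
    by rewrite divr_gt0// !mulr_gt0.
  (* The two entries of the minimum are what [cX] and [cZ] require: the surviving terms in [X] and
     [Z] must dominate [c] times the two terms of [dotv_block_le]. *)
  apply/strongly_convex_G; pose c := Num.min (alpha * mu / (4 * m%:R)) (1 / (16 * C)).
  exists c => [|x]; first by rewrite lt_min !divr_gt0 ?mulr_gt0.
  rewrite G_energy//.
  pose X := dotv (block x r) (block x r).
  pose Z := \sum_k dotv (block x k - block x r) (block x k - block x r).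
  have X0 : 0 <= X := dotvv_ge0 _.
  have Z0 : 0 <= Z by apply: sumr_ge0 => k _; exact: dotvv_ge0.
  have EZ : Z / C <= energy W (block x) by rewrite ler_pdivrMr// mulrC HC.
  have fX : mu * m%:R * X <= \sum_k f k (block x r).
    have := Hmu (block x r); rewrite -mean_fun_quad_form /mean_fun -/X.
    by rewrite mul1r ler_pdivlMl// mulrCA mulrA.
  have fx : mu / 2 * m%:R * X - K * Z <= \sum_k f k (block x k).
    have := HK (block x r) (fun k => block x k - block x r).
    under [leRHS]eq_bigr do rewrite subrKC.
    rewrite -/X -/Z; move: fX; rewrite /f; lra.
  have aK : alpha / m%:R * K <= 1 / (8 * C).
    rewrite ler_pdivlMr ?mulr_gt0// mulrAC -mulrA mulrAC ler_pdivrMr// mul1r.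
    move: aa0; rewrite ltr_pdivlMr ?mulr_gt0// => /ltW; lra.
  have cX : c * (2 * m%:R * X) <= alpha / m%:R * (mu / 2 * m%:R * X).
    have -> : alpha / m%:R * (mu / 2 * m%:R * X)
      = alpha * mu / (4 * m%:R) * (2 * m%:R * X) by field; rewrite gt_eqF.
    by rewrite ler_wpM2r ?ge_min ?lexx// !mulr_ge0// ltW.
  have cZ : c * (2 * Z) <= 1 / 8 * (Z / C).
    have -> : 1 / 8 * (Z / C) = 1 / (16 * C) * (2 * Z) by field; rewrite gt_eqF.
    by rewrite ler_wpM2r ?ge_min ?lexx ?orbT// mulr_ge0.
  have c0 : 0 <= c by rewrite le_min !divr_ge0// ?mulr_ge0// ltW.
  have := ler_wpM2l c0 (dotv_block_le r x); rewrite -/X -/Z mulrDr.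
  have := ler_wpM2l (ltW (divr_gt0 a0 m0)) fx; rewrite mulrBr.
  have := ler_wpM2r Z0 aK.
  have -> : 1 / (8 * C) * Z = 1 / 8 * (Z / C) by field; rewrite gt_eqF.
  lra.
split=> // convf scf alpha a0; have [alpha0 alpha00 H] := small scf.
(* Halving [alpha0] makes [b < alpha0] strict, while [b <= alpha] lets the constant [c] obtained at
   [b] serve at [alpha]. *)
pose b := Num.min alpha (alpha0 / 2).
have [ba b0] : b <= alpha /\ 0 < b < alpha0.
  rewrite ge_min lexx lt_min a0 gt_min; split => //; apply/andP; split; first lra.
  by apply/orP; right; lra.
have /strongly_convex_G[c c0 Hc] := H _ b0.
apply/strongly_convex_G; exists c => // x; apply: le_trans (Hc x) _.
rewrite !G_energy// lerD2r ler_wpM2r ?ler_pM2r ?invr_gt0//.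
by apply: sumr_ge0 => k _; exact: convex_quad_form_ge0 (convf k) _.
Qed.
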